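(* Let $f=\frac1N\sum_{j=1}^N f_j$ on the Riemannian manifold $\mathcal M$ satisfy the retraction smoothness assumption with constant $L_r>0$ and the bounded variance estimator assumption with constant $\sigma>0$ (both stated in the context). Let $K',l,l_w\in\mathbb N$ (positive integers), let $\gamma,\delta>1$ satisfy $\delta^{2l}<\gamma$, and let the total number of iterations $T$ and the number of warm-up iterations $T_w$ satisfy $T\ge T_w:=l_wK'\ge lK'$. Let the batch size be constant, $b_t=b>0$. Put $M'=\lfloor T/K'\rfloor$. For the first $T_w$ steps ($0\le t\le T_w-1$) let the learning rate be increasing, given for $m\in\{0,\dots,M'-1\}$ and integers $t\in[mK',(m+1)K')$ by one of: (E) exponential growth: $\eta_t=\eta_0\,\delta^{\,m\lceil t/((m+1)K')\rceil}$; (P) polynomial growth: $\eta_t=\left(s\,m\left\lceil \frac{t}{(m+1)K'}\right\rceil+\eta_0\right)^q$ with $s>0$, $q>1$. Put $\eta_{\max}=\eta_{T_w-1}$ and let $0\le\eta_{\min}\le\eta_{\max}<\frac2{L_r}$. For the remaining $T-T_w$ steps ($T_w\le t\le T-1$) let the learning rate (decay part) be one of: (1) constant: $\eta_t=\eta_{\max}$; (2) diminishing: $\eta_t=\frac{\eta_{\max}}{\sqrt{t+1}}$; (3) cosine annealing: $\eta_t=\eta_{\min}+\frac{\eta_{\max}-\eta_{\min}}2\left(1+\cos\frac{t}{T}\pi\right)$; (4) polynomial decay with exponent $p$: $\eta_t=\eta_{\min}+(\eta_{\max}-\eta_{\min})\left(1-\frac{t}{T}\right)^p$. Assume that $(\eta_t)_t$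 is positive-valued with $\eta_t\in[0,\eta_{\max}]\subset[0,\frac2{L_r})$. Let $(x_t)_t$ be generated by RSGD with these batch sizes and learning rates, and let $\|G_T\|^2=\min_{t\in\{0,\dots,T-1\}}\mathbb E[\|\mathrm{grad}f(x_t)\|_{x_t}^2]$. Then: (I) for the decay part (2), $\|G_T\|^2=O\left(\log\frac{T}{T_w}\,(\sqrt{T+1}-\sqrt{T_w+1})^{-1}\right)$; (II) for each of the decay parts (1), (3), (4), $\|G_T\|^2=O\left((T-T_w)^{-1}+b^{-1}\right)$.
   Context: $\mathcal M$ is a Riemannian manifold with inner product $\langle\cdot,\cdot\rangle_x$ and norm $\|\cdot\|_x$ on the tangent space $T_x\mathcal M$; $\mathrm{grad}$ denotes the Riemannian gradient. A retraction is a map $R\colon T\mathcal M\ni(x,v)\mapsto R_x(v)\in\mathcal M$ with $R_x(0_x)=x$ and $DR_x(0_x)=\mathrm{id}_{T_x\mathcal M}$ (identifying $T_{0_x}T_x\mathcal M\simeq T_x\mathcal M$) for all $x\in\mathcal M$; a retraction $R$ on $\mathcal M$ is fixed. Each $f_j\colon\mathcal M\to\mathbb R$ ($j=1,\dots,N$) is smooth and bounded below, and $f=\frac1N\sum_{j=1}^Nf_j$. Retraction smoothness: there is $L_r>0$ such that $f(R_x(v))\le f(x)+\langle\mathrm{grad}f(x),v\rangle_x+\frac{L_r}{2}\|v\|_x^2$ for all $x\in\mathcal M$, $v\in T_x\mathcal M$. Bounded variance estimator: $\Pi$ is a probability distribution on $\{1,\dots,N\}$ with (I) $\mathbb E_{\xi\sim\Pi}[\mathrm{grad}f_\xi(x)]=\mathrm{grad}f(x)$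 for all $x\in\mathcal M$, and (II) there is $\sigma>0$ with $\mathbb E_{\xi\sim\Pi}[\|\mathrm{grad}f_\xi(x)-\mathrm{grad}f(x)\|_x^2]\le\sigma^2$ for all $x\in\mathcal M$. RSGD (Riemannian stochastic gradient descent) with learning rates $\eta_t$ and batch sizes $b_t$: from a given initial point $x_0\in\mathcal M$, $x_{t+1}=R_{x_t}(-\eta_t\,\mathrm{grad}f_{B_t}(x_t))$, where $\mathrm{grad}f_{B_t}(x)=\frac1{b_t}\sum_{i=1}^{b_t}\mathrm{grad}f_{\xi_{i,t}}(x)$ and $(\xi_{i,t})_{i,t}$ are i.i.d. with law $\Pi$. $\mathbb E$ is the total expectation over all samples. The parameters $l$ and $\gamma$ enter only through the stated conditions $T_w\ge lK'$ and $\delta^{2l}<\gamma$. The constants implied in the $O$-notation do not depend on $T$. *)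

(* Defs.v *)
From HB Require Import structures.
From mathcomp Require Import all_boot all_order all_algebra.
From mathcomp Require Import all_classical all_reals all_analysis.

Set Implicit Arguments.
Unset Strict Implicit.
Unset Printing Implicit Defensive.

Import Order.TTheory GRing.Theory Num.Theory.
Import numFieldNormedType.Exports.

Local Open Scope classical_set_scope.
Local Open Scope ring_scope.

(* C^k maps on an open set, the derivative being tested in every direction;
   in finite dimension this is the usual class C^k. *)
Fixpoint Ck (R : realType) (V W : normedModType R) (k : nat) (U : set V)
    (h : V -> W) : Prop :=
  match k with
  | 0 => forall y, U y -> {for y, continuous h}
  | k'.+1 => (forall y, U y -> differentiable h y) /\
             forall v, Ck k' U (fun y => 'd h y v)
  end.

Definition smooth_on (R : realType) (V W : normedModType R) (U : set V)
  (h : V -> W) : Prop := forall k, Ck k U h.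

(* A chart is a homeomorphism from an open set of M onto an open set of R^n;
   both maps are total, with irrelevant values outside these open sets. *)
Record chart (R : realType) (n : nat) (M : topologicalType) := Chart {
  chart_dom : set M;
  chart_map : M -> 'rV[R]_n;
  chart_inv : 'rV[R]_n -> M;
  chart_dom_open : open chart_dom;
  chart_cod_open : open (chart_map @` chart_dom);
  chart_mapK : forall x, chart_dom x -> chart_inv (chart_map x) = x;
  chart_map_cont : forall x, chart_dom x -> {for x, continuous chart_map};
  chart_inv_cont : forall y, (chart_map @` chart_dom) y ->
    {for y, continuous chart_inv} }.

Record manifold (R : realType) (n : nat) := Manifold {
  carrier :> topologicalType;
  carrier_hausdorff : hausdorff_space carrier;
  carrier_second_countable : @second_countable carrier;
  atlas_index : Type;
  atlas : atlas_index -> chart R n carrier;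
  atlas_cover : forall x : carrier, exists i, chart_dom (atlas i) x;
  atlas_compatible : forall i j,
    smooth_on (chart_map (atlas i) @` (chart_dom (atlas i) `&` chart_dom (atlas j)))
      (chart_map (atlas j) \o chart_inv (atlas i)) }.

Section Geometry.
Variables (R : realType) (n : nat) (M : manifold R n).
Local Notation E := 'rV[R]_n.
Local Notation I := (atlas_index M).

Definition dom (i : I) : set M := chart_dom (atlas i).
Definition cod (i : I) : set E := chart_map (atlas i) @` dom i.
Definition phi (i : I) : M -> E := chart_map (atlas i).
Definition psi (i : I) : E -> M := chart_inv (atlas i).

Definition smooth_fun (f : M -> R) : Prop :=
  forall i, smooth_on (cod i) (f \o psi i : E -> R^o).

(* A tangent vector at x is the family of its coordinate vectors in the charts
   around x, related by the differentials of the transition maps; the entries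
   at the charts whose domain misses x are set to 0. *)
Definition tangent_pred (x : M) : {pred I -> E} := fun v =>
  `[< (forall i, ~ dom i x -> v i = 0) /\
      (forall i j, dom i x -> dom j x ->
         v j = 'd (phi j \o psi i) (phi i x) (v i)) >].

Fact tangent_submod_closed x : submod_closed (tangent_pred x).
Proof.
split=> [|a u v].
  apply/asboolP; split=> // i j _ _.
  by rewrite [RHS]linear0.
have E i : (a *: u + v) i = a *: u i + v i by [].
move=> /asboolP[u0 uT] /asboolP[v0 vT]; apply/asboolP; split=> [i xi|i j xi xj].
  by rewrite E u0// v0// scaler0 addr0.
by rewrite !E (uT i j)// (vT i j)// linearP.
Qed.
HB.instance Definition _ x :=
  GRing.isSubmodClosed.Build R (I -> E) (tangent_pred x)
    (tangent_submod_closed x).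

Record tangent (x : M) := Tangent {
  coords :> I -> E; coordsP : coords \in tangent_pred x }.

HB.instance Definition _ x := [isSub for @coords x].
HB.instance Definition _ x := [Choice of tangent x by <:].
HB.instance Definition _ x := [SubChoice_isSubLmodule of tangent x by <:].


Fact eq_near_diff (V W : normedModType R) (h k : V -> W) (y v : V) :
  differentiable h y -> differentiable k y -> (\near y, h y = k y) ->
  'd h y v = 'd k y v.
Proof. by move=> dh dk hk; rewrite -!deriveE//; exact: near_eq_derive. Qed.

Fact transition_diff (i j : I) (x : M) : dom i x -> dom j x ->
  differentiable (phi j \o psi i) (phi i x).
Proof.
by move=> xi xj; have [+ _] := @atlas_compatible _ _ M i j 1%N; apply; exists x.
Qed.

Fact near_dom (i j : I) (x : M) : dom i x -> dom j x ->
  \forall y \near phi i x, psi j (phi j (psi i y)) = psi i y.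
Proof.
move=> xi xj.
have cpsi : {for phi i x, continuous (psi i)} by apply: chart_inv_cont; exists x.
have nj : nbhs (psi i (phi i x)) (dom j).
  rewrite [psi i _]chart_mapK//; apply: open_nbhs_nbhs; split=> //.
  exact: chart_dom_open.
apply: (@filterS _ _ _ (psi i @^-1` dom j)); last exact: (cpsi _ nj).
by move=> y yj; apply: chart_mapK.
Qed.

Fact psiK (i : I) (x : M) : dom i x -> psi i (phi i x) = x.
Proof. exact: chart_mapK. Qed.

Fact transition_comp (i j k : I) (x : M) (u : E) :
  dom i x -> dom j x -> dom k x ->
  'd (phi k \o psi i) (phi i x) u =
  'd (phi k \o psi j) (phi j x) ('d (phi j \o psi i) (phi i x) u).
Proof.
move=> xi xj xk.
have dji := transition_diff xi xj.
have e : (phi j \o psi i) (phi i x) = phi j x := congr1 (phi j) (psiK xi).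
have dkj : differentiable (phi k \o psi j) ((phi j \o psi i) (phi i x)).
  by rewrite e; exact: transition_diff.
rewrite -e; apply: eq_trans (congr1 (fun h : E -> E => h u) (diff_comp dji dkj)).
apply: (eq_near_diff _ (transition_diff xi xk) (differentiable_comp dji dkj)).
by apply: filterS (near_dom xi xj) => y ye; rewrite /comp ye.
Qed.

Fact transition_id (i : I) (x : M) (u : E) : dom i x ->
  'd (phi i \o psi i) (phi i x) u = u.
Proof.
move=> xi; have did : is_diff (phi i x) (id : E -> E) id by exact: is_diff_id.
rewrite -[RHS]/((id : E -> E) u) -(@diff_val _ _ _ _ _ _ _ did).
apply: (eq_near_diff _ (transition_diff xi xi) (@ex_diff _ _ _ _ _ _ _ did)).
have oi : nbhs (phi i x) (cod i).
  apply: open_nbhs_nbhs; split; first exact: chart_cod_open.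
  by exists x.
by apply: filterS oi => _ [z zi <-] /=; rewrite psiK.
Qed.

(* The tangent vector at x whose coordinates in the chart i are u, for x in the
   domain of i (see of_coordE and of_coordK). *)
Definition of_coord (i : I) (x : M) (u : E) : tangent x :=
  insubd 0 (fun j => if `[< dom i x /\ dom j x >]
                     then 'd (phi j \o psi i) (phi i x) u else 0).

Lemma of_coordE i j (x : M) u : dom i x -> dom j x ->
  of_coord i x u j = 'd (phi j \o psi i) (phi i x) u.
Proof.
move=> xi xj; rewrite [coords _]insubdK; first by rewrite asboolT.
apply/asboolP; split=> [k xk|k l xk xl].
  by rewrite asboolF// => -[].
by rewrite !asboolT//; exact: transition_comp.
Qed.

Lemma of_coordK i (x : M) u : dom i x -> of_coord i x u i = u.
Proof. by move=> xi; rewrite of_coordE// transition_id. Qed.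

Lemma tangentP (x : M) (v : tangent x) i j : dom i x -> dom j x ->
  v j = 'd (phi j \o psi i) (phi i x) (v i).
Proof. by have /asboolP[_] := coordsP v; exact. Qed.

Lemma coordsK (x : M) (v : tangent x) i : dom i x -> of_coord i x (v i) = v.
Proof.
move=> xi; apply/val_inj/funext => j /=; have [xj|xj] := pselect (dom j x).
  by rewrite of_coordE// -tangentP.
have zero (w : tangent x) : w j = 0 by have /asboolP[+ _] := coordsP w; exact.
by rewrite !zero.
Qed.

Record riemannian_metric := RiemannianMetric {
  inner :> forall x : M, tangent x -> tangent x -> R;
  inner_sym : forall (x : M) (v w : tangent x), inner v w = inner w v;
  inner_linear : forall (x : M) (w : tangent x) (a : R) (u v : tangent x),
    inner (a *: u + v) w = a * inner u w + inner v w;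
  inner_gt0 : forall (x : M) (v : tangent x), v != 0 -> 0 < inner v v;
  inner_smooth : forall (i : I) (a b : 'I_n),
    smooth_on (cod i)
      (fun y => inner (of_coord i (psi i y) (delta_mx 0 a))
                      (of_coord i (psi i y) (delta_mx 0 b)) : R^o) }.

Definition tnorm (g : riemannian_metric) (x : M) (v : tangent x) : R :=
  Num.sqrt (g x v v).

(* The last two fields say that R_x is differentiable at 0_x with differential
   the identity, read in a chart around x; no further regularity is required. *)
Record retraction := Retraction {
  retr :> forall x : M, tangent x -> M;
  retr0 : forall x : M, retr (0 : tangent x) = x;
  retr_cont : forall i (x : M), dom i x ->
    {for (0 : E), continuous (fun u => retr (of_coord i x u))};
  retr_diff : forall i (x : M), dom i x ->
    is_diff (0 : E) (fun u => phi i (retr (of_coord i x u))) id }.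

(* w represents the differential of f at x through the metric. *)
Definition is_grad (g : riemannian_metric) (f : M -> R) (x : M) : set (tangent x) :=
  [set w | forall v i, dom i x ->
    g x w v = 'd (f \o psi i : E -> R^o) (phi i x) (v i)].

Definition grad (g : riemannian_metric) (f : M -> R) (x : M) : tangent x :=
  xget 0 (@is_grad g f x).

Fact row_linear (p : E -> R) : (forall a u v, p (a *: u + v) = a * p u + p v) ->
  forall v, p v = \sum_b v 0 b * p (delta_mx 0 b).
Proof.
move=> pL v; rewrite {1}(row_sum_delta v).
have p0 : p 0 = 0.
  by have := pL (- 1) 0 0; rewrite scaler0 addr0 mulN1r addNr.
by elim/big_rec2: _ => // b x y _ <-; rewrite pL.
Qed.

Fact of_coord_linear i (x : M) : dom i x -> forall a u v,
  of_coord i x (a *: u + v) = a *: of_coord i x u + of_coord i x v.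
Proof.
move=> xi a u v; rewrite -[RHS](coordsK _ xi); congr of_coord.
by rewrite -[RHS]/(a *: of_coord i x u i + of_coord i x v i) !of_coordK.
Qed.

Fact is_grad_unique g f (x : M) (w w' : tangent x) :
  is_grad g f w -> is_grad g f w' -> w = w'.
Proof.
move=> gw gw'; have [i xi] := atlas_cover x.
apply/eqP; rewrite -subr_eq0; apply/negP => /negP /(inner_gt0 g).
rewrite addrC -scaleN1r inner_linear (gw _ i)// (gw' _ i)// mulN1r addNr.
by rewrite ltxx.
Qed.

Fact diff_fun_chart f i j (x : M) (v : tangent x) : smooth_fun f ->
  dom i x -> dom j x ->
  'd (f \o psi j : E -> R^o) (phi j x) (v j) =
  'd (f \o psi i : E -> R^o) (phi i x) (v i).
Proof.
move=> sf xi xj; rewrite (tangentP v xi xj).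
have df k : dom k x -> differentiable (f \o psi k : E -> R^o) (phi k x).
  by move=> xk; have [+ _] := sf k 1%N; apply; exists x.
have e : (phi j \o psi i) (phi i x) = phi j x := congr1 (phi j) (psiK xi).
have dj : differentiable (f \o psi j : E -> R^o) ((phi j \o psi i) (phi i x)).
  by rewrite e; exact: df.
have dji := transition_diff xi xj.
rewrite -e; apply/esym.
apply: eq_trans (congr1 (fun h : E -> R^o => h (v i)) (diff_comp dji dj)).
apply: (eq_near_diff _ (df _ xi) (differentiable_comp dji dj)).
by apply: filterS (near_dom xi xj) => y ye; rewrite /comp ye.
Qed.

(* The gradient of a smooth function is the unique vector representing its
   differential, so that the default value in grad is never used. *)
Lemma gradP g f (x : M) : smooth_fun f -> is_grad g f (grad g f x).
Proof.
move=> sf; apply: (xgetPex 0); have [i xi] := atlas_cover x.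
pose tc := of_coord i x; pose l := 'd (f \o psi i : E -> R^o) (phi i x).
pose A := \matrix_(a, b) g x (tc (delta_mx 0 a)) (tc (delta_mx 0 b)).
have gA u b : g x (tc u) (tc (delta_mx 0 b)) = (u *m A) 0 b.
  rewrite (@row_linear (fun u => g x (tc u) (tc (delta_mx 0 b)))).
    by rewrite mxE; apply: eq_bigr => a _; rewrite mxE.
  by move=> a u' v; rewrite /tc of_coord_linear// inner_linear.
have gE u v : g x (tc u) (tc v) = \sum_b v 0 b * (u *m A) 0 b.
  rewrite (@row_linear (fun v => g x (tc u) (tc v))).
    by apply: eq_bigr => b _; rewrite gA.
  by move=> a u' v'; rewrite /tc of_coord_linear// ![inner _ (of_coord i x u) _]inner_sym inner_linear.
have uA : A \in unitmx.
  rewrite -row_free_unit -kermx_eq0; apply/rowV0P => u /sub_kermxP uA0.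
  have [tc0|/(inner_gt0 g)] := eqVneq (tc u) 0.
    by rewrite -[u](of_coordK u xi) -/tc tc0.
  by rewrite gE uA0 big1 ?ltxx// => b _; rewrite mxE mulr0.
exists (tc ((\row_b (l (delta_mx 0 b) : R)) *m invmx A)) => v j xj.
apply: eq_trans (esym (diff_fun_chart v sf xi xj)).
have vE : tc (v i) = v := coordsK v xi.
rewrite -[in LHS]vE gE (mulmxKV uA).
apply/esym/(eq_trans (@row_linear (fun u => l u : R) _ (v i))).
  by move=> a u' v'; rewrite linearP.
by apply: eq_bigr => b _; rewrite mxE.
Qed.

End Geometry.

Definition mean_fun (R : realType) (X : Type) (N : nat) (F : 'I_N -> X -> R) :
  X -> R := fun x => N%:R^-1 * \sum_j F j x.

Definition bounded_below (R : realType) (X : Type) (f : X -> R) : Prop :=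
  exists c, forall x, c <= f x.

Definition distribution_on (R : realType) (N : nat) (Pi : 'I_N -> R) : Prop :=
  (forall j, 0 <= Pi j) /\ \sum_j Pi j = 1.

Definition retraction_smooth (R : realType) (n : nat) (M : manifold R n)
    (g : riemannian_metric M) (Rt : retraction M) (f : M -> R) (L : R) : Prop :=
  forall (x : M) (v : tangent x),
    f (Rt x v) <= f x + g x (grad g f x) v + L / 2 * tnorm g v ^+ 2.

Definition unbiased (R : realType) (n : nat) (M : manifold R n)
    (g : riemannian_metric M) (N : nat) (F : 'I_N -> M -> R) (f : M -> R)
    (Pi : 'I_N -> R) : Prop :=
  forall x : M, \sum_j Pi j *: grad g (F j) x = grad g f x.

Definition variance_bounded (R : realType) (n : nat) (M : manifold R n)
    (g : riemannian_metric M) (N : nat) (F : 'I_N -> M -> R) (f : M -> R)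
    (Pi : 'I_N -> R) (sigma : R) : Prop :=
  forall x : M,
    \sum_j Pi j * tnorm g (grad g (F j) x - grad g f x) ^+ 2 <= sigma ^+ 2.

(* Samples xi i t indexed by the position i in the batch and the step t; the
   subsets of 'I_N form its discrete sigma-algebra. *)
Record iid_samples (R : realType) (d : measure_display)
    (Omega : measurableType d) (P : probability Omega R) (N : nat)
    (Pi : 'I_N -> R) (xi : nat -> nat -> Omega -> 'I_N) : Prop := IidSamples {
  samples_measurable : forall i t (A : set 'I_N), measurable (xi i t @^-1` A);
  samples_law : forall i t j, P (xi i t @^-1` [set j]) = (Pi j)%:E;
  samples_indep : forall (J : seq (nat * nat)) (A : nat * nat -> set 'I_N),
    uniq J ->
    P (\bigcap_(k in [set` J]) (xi k.1 k.2 @^-1` A k)) =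
    (\prod_(k <- J) P (xi k.1 k.2 @^-1` A k))%E }.

Fixpoint rsgd (R : realType) (n : nat) (M : manifold R n)
    (g : riemannian_metric M) (Rt : retraction M) (N : nat) (F : 'I_N -> M -> R)
    (x0 : M) (eta : nat -> R) (b : nat) (Omega : Type)
    (xi : nat -> nat -> Omega -> 'I_N) (t : nat) (omega : Omega) : M :=
  match t with
  | 0 => x0
  | t'.+1 =>
      let x := rsgd g Rt F x0 eta b xi t' omega in
      Rt x (- eta t' *: (b%:R^-1 *: \sum_(i < b) grad g (F (xi i t' omega)) x))
  end.

Variant warmup (R : realType) := ExpGrowth | PolyGrowth of R & R.
Arguments ExpGrowth {R}.

Definition warmup_ok (R : realType) (w : warmup R) : Prop :=
  match w with
  | ExpGrowth => True
  | PolyGrowth s q => 0 < s /\ 1 < q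
  end.

(* m = t %/ K is the integer such that m * K <= t < m.+1 * K; if
   t < lw * K <= T, then m < T %/ K. The parameter eta0 is the rate at t = 0 for
   exponential growth; for polynomial growth that rate is eta0 `^ q. *)
Definition warmup_rate (R : realType) (K : nat) (delta eta0 : R) (w : warmup R)
    (t : nat) : R :=
  let m := (t %/ K)%N in
  let c := Num.ceil (t%:R / (m.+1 * K)%:R : R) in
  match w with
  | ExpGrowth => eta0 * delta ^ (m%:Z * c)
  | PolyGrowth s q => (s * m%:R * c%:~R + eta0) `^ q
  end.

Variant decay (R : realType) :=
  Constant | Diminishing | CosineAnnealing | PolyDecay of R.
Arguments Constant {R}.
Arguments Diminishing {R}.
Arguments CosineAnnealing {R}.

Definition decay_rate (R : realType) (etamin etamax : R) (T : nat)
    (D : decay R) (t : nat) : R :=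
  match D with
  | Constant => etamax
  | Diminishing => etamax / Num.sqrt t.+1%:R
  | CosineAnnealing =>
      etamin + (etamax - etamin) / 2 * (1 + cos (t%:R / T%:R * pi))
  | PolyDecay p => etamin + (etamax - etamin) * (1 - t%:R / T%:R) `^ p
  end.

Definition learning_rate (R : realType) (K Tw : nat) (delta eta0 etamin : R)
    (w : warmup R) (D : decay R) (T t : nat) : R :=
  if (t < Tw)%N then warmup_rate K delta eta0 w t
  else decay_rate etamin (warmup_rate K delta eta0 w Tw.-1) T D t.

(* The expectations are extended reals, so that no integrability has to be
   assumed; the index set is nonempty when 0 < T. *)
Definition min_grad_norm2 (R : realType) (n : nat) (M : manifold R n)
    (g : riemannian_metric M) (f : M -> R) (d : measure_display)
    (Omega : measurableType d) (P : probability Omega R)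
    (x : nat -> Omega -> M) (T : nat) : \bar R :=
  (\big[mine/+oo]_(t < T)
     'E_P[fun omega => (tnorm g (grad g f (x t omega)) ^+ 2)%R])%E.

(* Main.v *)
(* Since the iterates up to time T depend on finitely many samples with values
   in a finite type, every expectation is a finite sum against a product weight.
   Retraction smoothness together with the unbiasedness and the variance sigma^2 / b
   of a batch gives, in expectation,
     f(x_(t+1)) <= f(x_t) - eta_t (1 - Lr eta_t / 2) |grad f(x_t)|^2
                   + Lr eta_t^2 sigma^2 / (2 b),
   and telescoping bounds the minimum by
     (f(x_0) - inf f + Lr sigma^2 / (2 b) * sum eta_t^2)
       / ((1 - Lr etamax / 2) * sum eta_t).
   The warm-up contributes the constant Tw etamax^2 to sum eta_t^2 and is dropped
   from sum eta_t. In the decay part, sums of 1 / sqrt(t+1) and 1 / (t+1) are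
   compared with differences of sqrt and ln; for the other schedules the rate is
   at least a fixed fraction of etamax on the first half of the decay part. *)
Require Import Defs.
From mathcomp Require Import all_boot all_order all_algebra.
From mathcomp Require Import all_classical all_reals all_analysis.
From mathcomp Require Import measurable_realfun zify ring lra.

Set Implicit Arguments.
Unset Strict Implicit.
Unset Printing Implicit Defensive.

Import Order.TTheory GRing.Theory Num.Theory.
Import numFieldNormedType.Exports.

Local Open Scope classical_set_scope.
Local Open Scope ring_scope.

(** * Expectation under a finite product law *)

Section FiniteProduct.
Variables (R : realFieldType) (K J : finType) (Pi : J -> R).
Hypothesis Pi_ge0 : forall j, 0 <= Pi j.
Hypothesis Pi_sum1 : \sum_j Pi j = 1.

Implicit Types (s u : {ffun K -> J}) (X Y : {ffun K -> J} -> R).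

Definition weight s : R := \prod_k Pi (s k).

Definition mean X : R := \sum_s weight s * X s.

Lemma weight_ge0 s : 0 <= weight s.
Proof. exact: prodr_ge0. Qed.

Lemma weight_sum1 : \sum_s weight s = 1.
Proof.
by rewrite -(bigA_distr_bigA (fun _ : K => Pi)) /= big1// => k _.
Qed.

Lemma mean_cst c : mean (fun=> c) = c.
Proof. by rewrite /mean -mulr_suml weight_sum1 mul1r. Qed.

Lemma meanD X Y : mean (fun s => X s + Y s) = mean X + mean Y.
Proof. by rewrite /mean -big_split; apply: eq_bigr => s _; rewrite mulrDr. Qed.

Lemma meanZ c X : mean (fun s => c * X s) = c * mean X.
Proof. by rewrite /mean mulr_sumr; apply: eq_bigr => s _; rewrite mulrCA. Qed.

Lemma mean_sum (I : Type) (r : seq I) (X : I -> {ffun K -> J} -> R) :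
  mean (fun s => \sum_(i <- r) X i s) = \sum_(i <- r) mean (X i).
Proof.
by rewrite /mean exchange_big; apply: eq_bigr => s _; rewrite mulr_sumr.
Qed.

Lemma le_mean X Y : (forall s, X s <= Y s) -> mean X <= mean Y.
Proof. by move=> XY; apply: ler_sum => s _; rewrite ler_wpM2l ?weight_ge0. Qed.

Lemma mean_coord (k : K) (h : J -> R) :
  mean (fun s => h (s k)) = \sum_j Pi j * h j.
Proof.
(* [H] inserts [h] in the factor of index [k] only: the sum over all functions then factors into
   one-coordinate sums, and all but one of them equal 1. *)
pose H i j := if i == k then Pi j * h j else Pi j.
transitivity (\sum_(s : {ffun K -> J}) \prod_i H i (s i)).
  apply: eq_bigr => s _; rewrite /weight (bigD1 k)//= [RHS](bigD1 k)//=.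
  rewrite /H eqxx mulrAC; congr (_ * _).
  by apply: eq_bigr => i /negPf ->.
rewrite -bigA_distr_bigA (bigD1 k)//= [X in _ * X]big1 ?mulr1.
  by apply: eq_bigr => j _; rewrite /H eqxx.
by move=> i /negPf ik; rewrite -Pi_sum1; apply: eq_bigr => j _; rewrite /H ik.
Qed.

Definition resample (D : pred K) s u : {ffun K -> J} :=
  [ffun k => if D k then u k else s k].

(* Exchanging the coordinates in D between two independent copies is an
   involution that preserves the product weight. *)
Lemma mean_resample (D : pred K) X :
  mean X = mean (fun s => mean (fun u => X (resample D s u))).
Proof.
pose swap (p : {ffun K -> J} * {ffun K -> J}) :=
  (resample D p.1 p.2, resample D p.2 p.1).
have swapK : involutive swap.
  case=> s u; rewrite /swap /=.
  by congr (_, _); apply/ffunP => k; rewrite !ffunE; case: (D k).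
have swap_weight p :
    weight (swap p).1 * weight (swap p).2 = weight p.1 * weight p.2.
  rewrite -!big_split; apply: eq_bigr => k _ /=; rewrite !ffunE.
  by case: (D k); rewrite // mulrC.
transitivity (\sum_p weight p.1 * weight p.2 * X p.1).
  rewrite -(pair_bigA _ (fun s u => weight s * weight u * X s)) /=.
  apply: eq_bigr => s _.
  by rewrite -!mulr_suml -mulr_sumr weight_sum1 mulr1.
rewrite (reindex_inj (inv_inj swapK)) /=.
rewrite /mean (eq_bigr (fun p => weight p.1 * (weight p.2 * X (resample D p.1 p.2)))).
  rewrite -(pair_bigA _ (fun s u => weight s * (weight u * X (resample D s u)))) /=.
  by apply: eq_bigr => s _; rewrite mulr_sumr.
by move=> p _; rewrite swap_weight mulrA.
Qed.

(** Redrawing the coordinate [k'] alone leaves [s k] fixed, which reduces the claim to two uses of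
    the one-coordinate formula. *)
Lemma mean_coord2 (k k' : K) (h : J -> J -> R) : k != k' ->
  mean (fun s => h (s k) (s k')) =
  \sum_j Pi j * \sum_j' Pi j' * h j j'.
Proof.
move=> kk'; rewrite (mean_resample (pred1 k')).
transitivity (mean (fun s => \sum_j' Pi j' * h (s k) j')).
  apply: eq_bigr => s _; congr (_ * _); rewrite -(mean_coord k').
  by apply: eq_bigr => u _; rewrite !ffunE /= (negPf kk') eqxx.
exact: (mean_coord k (fun j => \sum_j' Pi j' * h j j')).
Qed.

End FiniteProduct.

(** * From expectations on [Omega] to finite sums *)

Section Sampling.
Variables (R : realType) (d : measure_display) (Omega : measurableType d).
Variables (P : probability Omega R) (N : nat) (Pi : 'I_N -> R).
Variable xi : nat -> nat -> Omega -> 'I_N.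
Hypothesis xi_iid : iid_samples P Pi xi.
Variables (K : finType) (key : K -> nat * nat).
Hypothesis key_inj : injective key.

Definition sample (omega : Omega) : {ffun K -> 'I_N} :=
  [ffun k => xi (key k).1 (key k).2 omega].

Lemma sample_preimage s : sample @^-1` [set s] =
  \bigcap_(k in [set: K]) (xi (key k).1 (key k).2 @^-1` [set s k]).
Proof.
apply/seteqP; split=> [omega /= <- k _|omega /= xis]; first by rewrite /= ffunE.
by apply/ffunP => k; rewrite ffunE; exact: xis.
Qed.

Lemma measurable_sample s : measurable (sample @^-1` [set s]).
Proof.
rewrite sample_preimage; apply: fin_bigcap_measurable => // k _.
exact: (samples_measurable xi_iid).
Qed.

Lemma sample_law s : P (sample @^-1` [set s]) = (weight Pi s)%:E.
Proof.
(* [A] extends the prescribed values to all pairs, as independence requires; by injectivity of [key]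
   it is a singleton at each key. *)
pose A (c : nat * nat) := [set j | forall k, key k = c -> s k = j].
have AE k : A (key k) = [set s k].
  apply/seteqP; split=> [j /(_ k)/= ->//|j /= -> k' /key_inj ->//].
have := samples_indep xi_iid (J := map key (enum K)) A.
rewrite map_inj_uniq// enum_uniq => /(_ isT).
rewrite big_map big_enum /=.
under eq_bigr => k _ do rewrite AE (samples_law xi_iid).
rewrite prodEFin => <-; congr (P _); rewrite sample_preimage.
apply/seteqP; split=> [omega xis _ /= /mapP[k _ ->]|omega xis k _].
  by rewrite AE; exact: xis.
by rewrite -AE; apply: xis; rewrite /= map_f ?mem_enum.
Qed.

(** The finitely many events [sample = s] partition [Omega] and [h] is constant on each;
    nonnegativity allows the integral to pass through the sum. *)
Lemma expectation_sample (h : {ffun K -> 'I_N} -> R) : (forall s, 0 <= h s) ->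
  ('E_P[h \o sample] = (mean Pi h)%:E)%E.
Proof.
move=> h0; rewrite unlock.
have mI s : measurable_fun setT (\1_(sample @^-1` [set s]) : Omega -> R).
  by apply: measurable_indic; exact: measurable_sample.
transitivity (\int[P]_omega
    \sum_s ((h s)%:E * (\1_(sample @^-1` [set s]) omega)%:E))%E.
  apply: eq_integral => omega _; rewrite (bigD1 (sample omega))//=.
  rewrite indicE mem_set// mule1 big1 ?adde0// => s /eqP ns.
  by rewrite indicE memNset ?mule0// => /= e; exact: ns.
rewrite ge0_integral_sum//; last 2 first.
- by move=> s; apply/measurable_EFinP; apply: measurable_funM.
- by move=> s omega _; rewrite mule_ge0// lee_fin.
rewrite /mean -sumEFin; apply: eq_bigr => s _.
rewrite ge0_integralZl_EFin//; last exact/measurable_EFinP.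
rewrite integral_indic//; last exact: measurable_sample.
by rewrite setIT [X in (_ * X)%E]sample_law muleC.
Qed.

End Sampling.

(** * Bilinearity of the metric *)

Section InnerProduct.
Variables (R : realType) (n : nat) (M : manifold R n).
Variables (g : riemannian_metric M) (x : M).
Implicit Types (u v w : tangent x) (a : R).

Lemma innerDl u v w : g x (u + v) w = g x u w + g x v w.
Proof. by have := inner_linear g w 1 u v; rewrite scale1r mul1r. Qed.

Lemma inner0l w : g x 0 w = 0.
Proof. by apply: (addIr (g x 0 w)); rewrite -innerDl addr0 add0r. Qed.

Lemma innerZl a u w : g x (a *: u) w = a * g x u w.
Proof. by have := inner_linear g w a u 0; rewrite addr0 inner0l addr0. Qed.

Lemma innerDr w u v : g x w (u + v) = g x w u + g x w v.
Proof. by rewrite !(inner_sym g w) innerDl. Qed.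

Lemma innerZr a w u : g x w (a *: u) = a * g x w u.
Proof. by rewrite !(inner_sym g w) innerZl. Qed.

Lemma inner0r w : g x w 0 = 0.
Proof. by rewrite inner_sym inner0l. Qed.

Lemma inner_sumr (I : Type) (r : seq I) w (v : I -> tangent x) :
  g x w (\sum_(i <- r) v i) = \sum_(i <- r) g x w (v i).
Proof.
elim/big_rec2: _ => [|i y z _ <-]; first exact: inner0r.
exact: innerDr.
Qed.

Lemma inner_suml (I : Type) (r : seq I) w (v : I -> tangent x) :
  g x (\sum_(i <- r) v i) w = \sum_(i <- r) g x (v i) w.
Proof.
by rewrite inner_sym inner_sumr; apply: eq_bigr => i _; exact: inner_sym.
Qed.

Lemma tnormE v : tnorm g v ^+ 2 = g x v v.
Proof.
rewrite /tnorm sqr_sqrtr//; have [->|/(inner_gt0 g)/ltW//] := eqVneq v 0.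
by rewrite inner0l.
Qed.

End InnerProduct.

(** * Mean and variance of a batch gradient at a fixed point *)

Section Batch.
Variables (R : realType) (n : nat) (M : manifold R n).
Variables (g : riemannian_metric M) (x : M).
Variables (N : nat) (Pi : 'I_N -> R).
Hypothesis Pi_sum1 : \sum_j Pi j = 1.
Variables (K : finType) (b : nat) (key : 'I_b -> K).
Hypothesis key_inj : injective key.
Hypothesis b_gt0 : (0 < b)%N.
Variables (v : 'I_N -> tangent x) (mu : tangent x) (sigma : R).
Hypothesis v_mean : \sum_j Pi j *: v j = mu.
Hypothesis v_var : \sum_j Pi j * tnorm g (v j - mu) ^+ 2 <= sigma ^+ 2.

Definition batch (s : {ffun K -> 'I_N}) : tangent x :=
  b%:R^-1 *: \sum_(i < b) v (s (key i)).

Let b_neq0 : (b%:R : R) != 0.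
Proof. by rewrite pnatr_eq0 -lt0n. Qed.

Lemma eq_batch (s s' : {ffun K -> 'I_N}) :
  (forall i, s (key i) = s' (key i)) -> batch s = batch s'.
Proof. by move=> ss'; rewrite /batch; under eq_bigr => i _ do rewrite ss'. Qed.

Lemma mean_inner_batch u : mean Pi (fun s => g x u (batch s)) = g x u mu.
Proof.
have E i : mean Pi (fun s => g x u (v (s (key i)))) = g x u mu.
  rewrite (mean_coord Pi_sum1 (key i) (fun j => g x u (v j))) -v_mean inner_sumr.
  by apply: eq_bigr => j _; rewrite innerZr.
under eq_fun => s do rewrite innerZr inner_sumr.
rewrite meanZ mean_sum (eq_bigr _ (fun i _ => E i)) sumr_const card_ord.
by rewrite -[X in _ * X]mulr_natl mulKf.
Qed.

Lemma batch_centered s :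
  batch s - mu = b%:R^-1 *: \sum_(i < b) (v (s (key i)) - mu).
Proof.
rewrite sumrB sumr_const card_ord scalerBr; congr (_ - _).
by rewrite -[mu *+ b]scaler_nat scalerA mulVf// scale1r.
Qed.

Let c j := v j - mu.

Let c_mean : \sum_j Pi j *: c j = 0.
Proof.
under eq_bigr => j _ do rewrite scalerBr.
by rewrite sumrB v_mean -scaler_suml Pi_sum1 scale1r subrr.
Qed.

(** Distinct positions are independent and centered, so their covariance vanishes; on the diagonal
    the variance assumption applies. *)
Lemma mean_inner_centered (i i' : 'I_b) :
  mean Pi (fun s => g x (c (s (key i))) (c (s (key i')))) <=
  if i' == i then sigma ^+ 2 else 0.
Proof.
case: eqVneq => [->|ii'].
  rewrite (mean_coord Pi_sum1 (key i) (fun j => g x (c j) (c j))).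
  by apply: le_trans v_var; apply: ler_sum => j _; rewrite tnormE.
rewrite (mean_coord2 Pi_sum1 (fun j j' => g x (c j) (c j'))) ?inj_eq 1?eq_sym//.
rewrite big1// => j _; transitivity (Pi j * g x (c j) (\sum_j' Pi j' *: c j')).
  by rewrite inner_sumr; congr (_ * _); apply: eq_bigr => j' _; rewrite innerZr.
by rewrite c_mean inner0r mulr0.
Qed.

(** The square expands into [b ^ 2] covariances, of which only the [b] diagonal ones contribute; the
    prefactor [b ^ -2] leaves one factor [1 / b]. *)
Lemma batch_variance :
  mean Pi (fun s => tnorm g (batch s - mu) ^+ 2) <= sigma ^+ 2 / b%:R.
Proof.
under eq_fun => s do rewrite tnormE batch_centered innerZl innerZr inner_suml.
under eq_fun => s do under eq_bigr => i _ do rewrite inner_sumr.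
rewrite !meanZ mean_sum; under eq_bigr => i _ do rewrite mean_sum.
have sum_le : \sum_(i < b) \sum_(i' < b)
    mean Pi (fun s => g x (c (s (key i))) (c (s (key i')))) <= b%:R * sigma ^+ 2.
  rewrite mulr_natl -[X in _ *+ X]card_ord -sumr_const; apply: ler_sum => i _.
  apply: (le_trans (ler_sum _ (fun i' _ => mean_inner_centered i i'))).
  by rewrite -big_mkcond big_pred1_eq.
have := ler_wpM2l (_ : 0 <= b%:R^-1 * b%:R^-1) sum_le.
rewrite mulr_ge0 ?invr_ge0// -mulrA -[leRHS]mulrA mulKf// => /(_ isT).
by rewrite [sigma ^+ 2 / _]mulrC.
Qed.

Lemma batch_second_moment :
  mean Pi (fun s => tnorm g (batch s) ^+ 2) <=
  tnorm g mu ^+ 2 + sigma ^+ 2 / b%:R.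
Proof.
(* Expansion around [mu] in which the cross term is linear in the batch, so that its mean is already
   known. *)
have E s : tnorm g (batch s) ^+ 2 =
    tnorm g (batch s - mu) ^+ 2 + (2 * g x mu (batch s) + - g x mu mu).
  move: (batch s) => B; rewrite !tnormE -scaleN1r.
  by rewrite !(innerDl, innerDr, innerZl, innerZr) (inner_sym g B); ring.
under eq_fun => s do rewrite E.
rewrite meanD meanD meanZ mean_inner_batch mean_cst// tnormE.
by have := batch_variance; lra.
Qed.

End Batch.

(** * One step of RSGD and its dependence on the samples *)

Definition rsgd_step (R : realType) (n : nat) (M : manifold R n)
    (g : riemannian_metric M) (Rt : retraction M) (N : nat) (F : 'I_N -> M -> R)
    (eta : R) (b : nat) (x : M) (j : 'I_b -> 'I_N) : M :=
  Rt x (- eta *: (b%:R^-1 *: \sum_(i < b) grad g (F (j i)) x)).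

(** Causality of the recursion. The two sample spaces may differ, which serves both for resampling
    and for the passage from [Omega] to the finite product. *)
Lemma eq_rsgd (R : realType) (n : nat) (M : manifold R n)
    (g : riemannian_metric M) (Rt : retraction M) (N : nat) (F : 'I_N -> M -> R)
    (x0 : M) (eta : nat -> R) (b : nat) (Omega Omega' : Type)
    (xi : nat -> nat -> Omega -> 'I_N) (xi' : nat -> nat -> Omega' -> 'I_N)
    (omega : Omega) (omega' : Omega') (t : nat) :
  (forall i u, (i < b)%N -> (u < t)%N -> xi i u omega = xi' i u omega') ->
  rsgd g Rt F x0 eta b xi t omega = rsgd g Rt F x0 eta b xi' t omega'.
Proof.
elim: t => [//|t IHt xiE].
have xiE' : (fun i : 'I_b => xi i t omega) = (fun i : 'I_b => xi' i t omega').
  by apply/funext => i; rewrite xiE.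
change (rsgd_step g Rt F (eta t) (rsgd g Rt F x0 eta b xi t omega)
    (fun i : 'I_b => xi i t omega) =
  rsgd_step g Rt F (eta t) (rsgd g Rt F x0 eta b xi' t omega')
    (fun i : 'I_b => xi' i t omega')).
by rewrite xiE' IHt// => i u ib ut; rewrite xiE// ltnS ltnW.
Qed.

(** * Expected descent on the finite sample space *)

Section Descent.
Variables (R : realType) (n : nat) (M : manifold R n).
Variables (g : riemannian_metric M) (Rt : retraction M).
Variables (N : nat) (F : 'I_N -> M -> R) (f : M -> R) (Pi : 'I_N -> R).
Variables (Lr sigma : R).
Hypothesis f_smooth : retraction_smooth g Rt f Lr.
Hypothesis Pi_dist : distribution_on Pi.
Hypothesis F_unbiased : unbiased g F f Pi.
Hypothesis Lr_gt0 : 0 < Lr.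
Hypothesis F_var : variance_bounded g F f Pi sigma.
Variables (x0 : M) (eta : nat -> R) (b T : nat).
Hypothesis b_gt0 : (0 < b)%N.
Variable j0 : 'I_N.

(* The value j0 outside the range of the indices is irrelevant. *)
Definition coordinate (i t : nat) (s : {ffun 'I_b * 'I_T -> 'I_N}) : 'I_N :=
  if (insub i, insub t) is (Some i', Some t') then s (i', t') else j0.

Lemma coordinateE (i : 'I_b) (t : 'I_T) s : coordinate i t s = s (i, t).
Proof. by rewrite /coordinate !valK. Qed.

Definition iterate := rsgd g Rt F x0 eta b coordinate.

Let grads x (j : 'I_N) := grad g (F j) x.
Let row (t : 'I_T) (i : 'I_b) := (i, t).

Let Pi_ge0 := Pi_dist.1.
Let Pi_sum1 := Pi_dist.2.

Lemma iterateS (t : 'I_T) s : iterate t.+1 s =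
  Rt (iterate t s) (- eta t *: batch (row t) (grads (iterate t s)) s).
Proof.
transitivity (rsgd_step g Rt F (eta t) (iterate t s)
  (fun i : 'I_b => coordinate i t s)); first by [].
have -> : (fun i : 'I_b => coordinate i t s) = (fun i => s (row t i)).
  by apply/funext => i; rewrite coordinateE.
by [].
Qed.

(** The iterate at time [t] reads only earlier steps, so redrawing batch [t] does not move it; in
    the inner mean it is a fixed point. *)
Lemma mean_batch_indep (t : 'I_T) (h : forall x : M, tangent x -> R) :
  mean Pi (fun s => h (iterate t s) (batch (row t) (grads (iterate t s)) s)) =
  mean Pi (fun s => mean Pi (fun u =>
    h (iterate t s) (batch (row t) (grads (iterate t s)) u))).
Proof.
rewrite (mean_resample Pi_sum1 (fun k => k.2 == t)).
apply: eq_bigr => s _; congr (_ * _); apply: eq_bigr => u _; congr (_ * _).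
have -> : iterate t (resample (fun k => k.2 == t) s u) = iterate t s.
  apply: eq_rsgd => i r ib rt; rewrite -[i]/(val (Ordinal ib)).
  rewrite -[r]/(val (Ordinal (ltn_trans rt (ltn_ord t)))) !coordinateE ffunE /=.
  by rewrite -val_eqE /= ltn_eqF.
apply: (congr1 (h (iterate t s))).
by apply: eq_batch => i; rewrite ffunE eqxx.
Qed.

Definition mean_grad2 t :=
  mean Pi (fun s => tnorm g (grad g f (iterate t s)) ^+ 2).

Lemma mean_descent (t : 'I_T) :
  mean Pi (fun s => f (iterate t.+1 s)) <=
  mean Pi (fun s => f (iterate t s))
  - eta t * (1 - Lr * eta t / 2) * mean_grad2 t
  + Lr / 2 * eta t ^+ 2 * (sigma ^+ 2 / b%:R).
Proof.
pose B s := batch (row t) (grads (iterate t s)) s.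
have step s : f (iterate t.+1 s) <= f (iterate t s) +
    (- eta t * g _ (grad g f (iterate t s)) (B s) +
     Lr / 2 * eta t ^+ 2 * tnorm g (B s) ^+ 2).
  rewrite iterateS; apply: (le_trans (f_smooth _)).
  by rewrite !tnormE !(innerZl, innerZr) -/(B s) -addrA; lra.
apply: (le_trans (le_mean Pi_ge0 step)); rewrite !meanD !meanZ -addrA lerD2l.
(* With the past frozen, the batch moments at a fixed point give the linear and the quadratic
   term. *)
have row_inj : injective (row t) by move=> i i' [].
have mean1 : mean Pi (fun s => g _ (grad g f (iterate t s)) (B s)) = mean_grad2 t.
  rewrite (mean_batch_indep t (fun x v => g x (grad g f x) v)).
  apply: eq_bigr => s _; congr (_ * _); rewrite tnormE.
  exact: (mean_inner_batch g Pi_sum1 _ b_gt0 (F_unbiased _)).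
have mean2 : mean Pi (fun s => tnorm g (B s) ^+ 2) <=
    mean_grad2 t + sigma ^+ 2 / b%:R.
  rewrite (mean_batch_indep t (fun x v => tnorm g v ^+ 2)).
  rewrite -(mean_cst ('I_b * 'I_T)%type Pi_sum1 (sigma ^+ 2 / _)) -meanD.
  apply: le_mean => // s.
  exact: (batch_second_moment Pi_sum1 row_inj b_gt0 (F_unbiased _) (F_var _)).
rewrite mean1.
have c0 : 0 <= Lr / 2 * eta t ^+ 2 by rewrite mulr_ge0 ?sqr_ge0// divr_ge0// ltW.
by have := ler_wpM2l c0 mean2; lra.
Qed.

Variable fmin : R.
Hypothesis fmin_le : forall x, fmin <= f x.

Lemma weighted_grad2_sum :
  \sum_(t < T) eta t * (1 - Lr * eta t / 2) * mean_grad2 t <=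
  f x0 - fmin + Lr / 2 * (sigma ^+ 2 / b%:R) * \sum_(t < T) eta t ^+ 2.
Proof.
pose a t := mean Pi (fun s => f (iterate t s)).
have a0 : a 0%N = f x0 := mean_cst _ Pi_sum1 (f x0).
have aT : fmin <= a T.
  rewrite -(mean_cst ('I_b * 'I_T)%type Pi_sum1 fmin).
  exact: le_mean.
have tele : \sum_(t < T) (a t - a t.+1) = a 0%N - a T.
  rewrite -[RHS]opprB -(telescope_sumr _ (leq0n T)) big_mkord -sumrN.
  by apply: eq_bigr => t _; rewrite opprB.
apply: (@le_trans _ _ (a 0%N - a T +
    Lr / 2 * (sigma ^+ 2 / b%:R) * \sum_(t < T) eta t ^+ 2)).
  rewrite -tele mulr_sumr -big_split /=; apply: ler_sum => t _.
  by have := mean_descent t; rewrite -/(a _) -/(a _); lra.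
by rewrite a0; lra.
Qed.

(** By contradiction: if every squared norm exceeded the ratio, the weighted sum would exceed its
    own upper bound. *)
Lemma exists_small_grad2 (etamax : R) : (0 < T)%N ->
  (forall t, (t < T)%N -> 0 < eta t <= etamax) -> etamax < 2 / Lr ->
  exists t : 'I_T, mean_grad2 t <=
    (f x0 - fmin + Lr / 2 * (sigma ^+ 2 / b%:R) * \sum_(t < T) eta t ^+ 2) /
    ((1 - Lr * etamax / 2) * \sum_(t < T) eta t).
Proof.
move=> T0 etaP etamax_lt; set A := (X in X / _).
have kappa0 : 0 < 1 - Lr * etamax / 2.
  by move: etamax_lt; rewrite ltr_pdivlMr//; lra.
have eta0 t : (t < T)%N -> 0 < eta t by move=> /etaP/andP[].
have sum0 : 0 < \sum_(t < T) eta t.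
  rewrite (bigD1 (Ordinal T0))//= ltr_wpDr ?eta0// sumr_ge0// => i _.
  by rewrite ltW ?eta0.
apply/not_existsP => small.
have := weighted_grad2_sum; rewrite -/A leNgt => /negP; apply.
have D0 : 0 < (1 - Lr * etamax / 2) * \sum_(t < T) eta t by rewrite mulr_gt0.
(* The numerator is spread over the steps in proportion to [eta t], to be compared term by term. *)
have -> : A = \sum_(t < T) eta t * ((1 - Lr * etamax / 2) *
    (A / ((1 - Lr * etamax / 2) * \sum_(t < T) eta t))).
  have cancelE (S k a : R) : S != 0 -> k != 0 -> a = S * (k * (a / (k * S))).
    by move=> S0 k0; field; rewrite S0.
  by rewrite -mulr_suml; apply: cancelE; rewrite lt0r_neq0.
have lt_term (t : 'I_T) : eta t * ((1 - Lr * etamax / 2) *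
      (A / ((1 - Lr * etamax / 2) * \sum_(t < T) eta t))) <
    eta t * (1 - Lr * eta t / 2) * mean_grad2 t.
  have /negP := small t; rewrite -ltNge => lt_t.
  have /andP[eta_gt0 eta_le] := etaP t (ltn_ord t).
  rewrite -[ltRHS]mulrA ltr_pM2l//.
  apply: (@lt_le_trans _ _ ((1 - Lr * etamax / 2) * mean_grad2 t)).
    by rewrite ltr_pM2l.
  apply: ler_wpM2r; last by have := ler_wpM2l (ltW Lr_gt0) eta_le; lra.
  by apply: sumr_ge0 => s _; rewrite mulr_ge0 ?weight_ge0// sqr_ge0.
apply: ltr_sum => //; apply/hasP; exists (Ordinal T0) => //.
Qed.

End Descent.

Lemma min_grad_norm2_le (R : realType) (n : nat) (M : manifold R n)
    (g : riemannian_metric M) (Rt : retraction M)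
    (N : nat) (F : 'I_N -> M -> R) (f : M -> R) (Lr sigma : R) (Pi : 'I_N -> R)
    (d : measure_display) (Omega : measurableType d) (P : probability Omega R)
    (xi : nat -> nat -> Omega -> 'I_N) (x0 : M) (fmin etamax : R)
    (eta : nat -> R) (T b : nat) :
  (0 < N)%N -> 0 < Lr -> retraction_smooth g Rt f Lr ->
  distribution_on Pi -> unbiased g F f Pi -> variance_bounded g F f Pi sigma ->
  iid_samples P Pi xi -> (forall x, fmin <= f x) ->
  (0 < T)%N -> (0 < b)%N ->
  (forall t, (t < T)%N -> 0 < eta t <= etamax) -> etamax < 2 / Lr ->
  (min_grad_norm2 g f P (rsgd g Rt F x0 eta b xi) T <=
    ((f x0 - fmin + Lr / 2 * (sigma ^+ 2 / b%:R) * \sum_(t < T) eta t ^+ 2) /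
     ((1 - Lr * etamax / 2) * \sum_(t < T) eta t))%:E)%E.
Proof.
move=> N0 Lr0 smf Pid unb var iid fmin_le T0 b0 etaP etamax_lt.
pose j0 := Ordinal N0.
have [t] := exists_small_grad2 smf Pid unb Lr0 var x0 b0 j0 fmin_le T0 etaP etamax_lt.
rewrite -lee_fin => le_t; apply: (bigmin_inf t) => //.
(* The two sides are in fact equal: up to time [t] the run on [Omega] reads only samples of the [b]
   by [T] grid. *)
apply: le_trans le_t; rewrite le_eqVlt; apply/orP; left; apply/eqP.
pose key (k : 'I_b * 'I_T) := (val k.1, val k.2).
have key_inj : injective key.
  by move=> [i r] [i' r'] [/val_inj -> /val_inj ->].
rewrite /mean_grad2 -(expectation_sample iid key_inj); last by move=> s; exact: sqr_ge0.
congr expectation; apply/funext => omega /=; congr (tnorm g (grad g f _) ^+ 2).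
apply: eq_rsgd => i r ib rt; rewrite -[i]/(val (Ordinal ib)).
rewrite -[r]/(val (Ordinal (ltn_trans rt (ltn_ord t)))) coordinateE.
by rewrite ffunE.
Qed.

(** * Sums of learning rates *)

Section Rates.
Variable R : realType.
Implicit Types (eta : nat -> R) (T m k : nat).

(** Used to drop the warm-up, and for some schedules also the end of the decay part, from the sum of
    the rates. *)
Lemma subsum_le eta T m k : (forall t, (t < T)%N -> 0 <= eta t) ->
  (m <= k <= T)%N -> \sum_(m <= t < k) eta t <= \sum_(t < T) eta t.
Proof.
move=> eta0 /andP[mk kT].
have sum0 i j : (j <= T)%N -> 0 <= \sum_(i <= t < j) eta t.
  move=> jT; rewrite big_seq sumr_ge0// => t.
  by rewrite mem_index_iota => /andP[_ tj]; rewrite eta0// (leq_trans tj).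
have mT := leq_trans mk kT.
rewrite -(big_mkord predT eta) (big_cat_nat (leq0n m) mT)/=.
by rewrite (big_cat_nat mk kT)/= addrCA lerDl addr_ge0 ?sum0.
Qed.

Lemma sum_inv_sqrt_ge m k : (m <= k)%N ->
  2 * (Num.sqrt k.+1%:R - Num.sqrt m.+1%:R) <=
  \sum_(m <= t < k) (Num.sqrt t.+1%:R)^-1 :> R.
Proof.
move=> mk; rewrite -(telescope_sumr (fun t => Num.sqrt t.+1%:R : R) mk) mulr_sumr.
apply: ler_sum => t _.
have a0 : 0 < Num.sqrt t.+1%:R :> R by rewrite sqrtr_gt0 ltr0n.
have c0 : 0 <= Num.sqrt t.+2%:R :> R by rewrite sqrtr_ge0.
have a2 : Num.sqrt t.+1%:R ^+ 2 = t.+1%:R :> R by rewrite sqr_sqrtr.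
have c2 : Num.sqrt t.+2%:R ^+ 2 = t.+2%:R :> R by rewrite sqr_sqrtr.
move: a0 c0 a2 c2; rewrite -[t.+2]addn1 natrD.
set a := Num.sqrt _; set c := Num.sqrt _ => a0 c0 a2 c2.
(* Since [c ^ 2 = a ^ 2 + 1], expanding this square gives [2 a (c - a) <= 1]. *)
have := sqr_ge0 (c - a).
by rewrite -[_^-1]mul1r ler_pdivlMr// => ?; nra.
Qed.

Lemma sum_inv_le_ln m k : (0 < m <= k)%N ->
  \sum_(m <= t < k) t.+1%:R^-1 <= ln (k%:R / m%:R) :> R.
Proof.
move=> /andP[m0 mk].
have k0 : (0 < k)%N := leq_trans m0 mk.
rewrite ln_div ?posrE ?ltr0n// -(telescope_sumr (fun t => ln (t%:R : R)) mk).
rewrite big_seq [leRHS]big_seq; apply: ler_sum => t.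
rewrite mem_index_iota => /andP[mt _].
have t0 : 0 < t%:R :> R by rewrite ltr0n (leq_trans m0).
have t1 : 0 < t.+1%:R :> R by rewrite ltr0n.
have u1 : t.+1%:R^-1 < 1 :> R by rewrite invf_lt1// ltr1n ltnS (leq_trans m0).
(* The inequality [ln (1 + x) <= x] at [x = - 1 / (t + 1)] bounds [1 / (t + 1)] by
   [ln (t + 1) - ln t]. *)
have : ln (1 + - t.+1%:R^-1) <= - t.+1%:R^-1 :> R.
  by apply: le_ln1Dx; rewrite ltrN2.
have -> : 1 + - t.+1%:R^-1 = t%:R / t.+1%:R :> R.
  by rewrite -natr1 in t1 *; field; rewrite lt0r_neq0.
by rewrite ln_div ?posrE// => ln_le; rewrite -lerN2 opprB.
Qed.

(* With m warm-up steps out of k and t in the first half of the decay part; the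
   bound does not depend on k. *)
Lemma remaining_fraction_ge m k t : (m < k)%N -> (m <= t)%N ->
  (2 * (t - m) <= k - m)%N -> (2 * m.+1)%:R^-1 <= 1 - t%:R / k%:R :> R.
Proof.
move=> mk mt tk; have tk2 : (2 * t <= k + m)%N by lia.
have k0 : 0 < k%:R :> R by rewrite ltr0n; lia.
have m0 : 0 <= m%:R :> R by [].
have mk' : m%:R + 1 <= k%:R :> R by rewrite natr1 ler_nat.
have tk' : 2 * t%:R <= k%:R + m%:R :> R by rewrite -natrM -natrD ler_nat.
have -> : 1 - t%:R / k%:R = (k%:R - t%:R) / k%:R :> R by field; rewrite lt0r_neq0.
rewrite ler_pdivlMr// mulrC ler_pdivrMr ?ltr0n// natrM -natr1.
by nra.
Qed.

(** The non-constant schedules interpolate between [etamin] and [etamax], with a weight that stays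
    away from 0 on the first half of the decay part. As [theta] precedes [k] and [t], it is uniform
    in the horizon. *)
Lemma decay_rate_ge (etamin etamax : R) (m : nat) (D : decay R) :
  0 <= etamin -> etamin <= etamax ->
  [\/ D = Constant, D = CosineAnnealing | exists p, D = PolyDecay p] ->
  exists2 theta : R, 0 < theta & forall k t, (m < k)%N -> (m <= t)%N ->
    (2 * (t - m) <= k - m)%N -> theta * etamax <= decay_rate etamin etamax k D t.
Proof.
move=> min0 minmax hD; pose a : R := (2 * m.+1)%:R^-1.
have a0 : 0 < a by rewrite invr_gt0 ltr0n.
have a1 : a <= 1 by rewrite invf_le1 ?ltr0n// ler1n.
have interp (theta y : R) : theta <= 1 -> theta <= y ->
    theta * etamax <= etamin + (etamax - etamin) * y.
  move=> theta1 thetay; have d0 : 0 <= etamax - etamin by lra.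
  by have := ler_wpM2l d0 thetay; nra.
case: hD => [->|->|[p ->]].
- by exists 1 => // k t _ _ _; rewrite mul1r.
- have pi0 := pi_gt0 R.
  (* The angle stays below [pi * (1 - a)], and the cosine decreases on [[0, pi]]. *)
  have ca : -1 < cos (pi * (1 - a)).
    by rewrite -(cospi R) ltr_cos ?in_itv/=; [nra|apply/andP; split; nra|apply/andP; split; nra].
  exists ((1 + cos (pi * (1 - a))) / 2) => [|k t mk mt tk]; first by lra.
  rewrite /= -[X in etamin + X]mulrA; apply: interp.
    by have := cos_le1 (pi * (1 - a)); lra.
  have := remaining_fraction_ge mk mt tk; rewrite -/a => ale.
  have r0 : 0 <= t%:R / k%:R :> R by rewrite divr_ge0.
  suff : cos (pi * (1 - a)) <= cos (t%:R / k%:R * pi) by lra.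
  by rewrite leNgt ltr_cos ?in_itv -?leNgt/=; [nra|apply/andP; split; nra|apply/andP; split; nra].
(* The minimum covers both signs of [p]: the weight is at least [a ^ p] if [p] is nonnegative and at
   least 1 otherwise. *)
- exists (Num.min 1 (a `^ p)) => [|k t mk mt tk]; first by rewrite lt_min ltr01 powR_gt0.
  apply: interp; first by rewrite ge_min lexx.
  have := remaining_fraction_ge mk mt tk; rewrite -/a => ale.
  have y1 : 1 - t%:R / k%:R <= 1 :> R by rewrite gerBl divr_ge0.
  rewrite ge_min; have [p0|p0] := leP 0 p.
    by rewrite ge0_ler_powR ?orbT// nnegrE; lra.
  have := @ger_powR _ (1 - t%:R / k%:R) _ p 0 (ltW p0).
  by rewrite powRr0 => -> //; apply/andP; split; lra.
Qed.

End Rates.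

(** * Assembly of the convergence rates *)

Lemma mean_fun_bounded_below (R : realType) (X : Type) (N : nat)
    (F : 'I_N -> X -> R) :
  (forall j, bounded_below (F j)) -> bounded_below (mean_fun F).
Proof.
move=> /fin_all_exists[c cF]; exists (N%:R^-1 * \sum_j c j) => x.
by rewrite ler_wpM2l ?invr_ge0// ler_sum.
Qed.

(** The successor lets the window cover at least half of the [k - m] steps when this number is odd,
    while [t < h] still keeps [t] in the first half. *)
Lemma half_window (m k : nat) (h := (m + (k - m)./2.+1)%N) : (m < k)%N ->
  [/\ (h <= k)%N, (k - m <= (h - m) * 2)%N &
      forall t, (m <= t < h)%N -> (2 * (t - m) <= k - m)%N].
Proof. by rewrite /h => mk; split=> [||t]; lia. Qed.

Theorem theorem8 (R : realType) (n : nat) (M : manifold R n)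
    (g : riemannian_metric M) (Rt : retraction M)
    (N : nat) (F : 'I_N -> M -> R) (Lr sigma : R) (Pi : 'I_N -> R)
    (d : measure_display) (Omega : measurableType d) (P : probability Omega R)
    (xi : nat -> nat -> Omega -> 'I_N) (x0 : M)
    (K l lw : nat) (gamma delta eta0 etamin : R) (w : warmup R)
    (f := mean_fun F) (Tw := (lw * K)%N)
    (etamax := warmup_rate K delta eta0 w Tw.-1)
    (eta := learning_rate K Tw delta eta0 etamin w)
    (G2 := fun (D : decay R) (T b : nat) =>
       min_grad_norm2 g f P (rsgd g Rt F x0 (eta D T) b xi) T)
    (admissible := fun (D : decay R) (T : nat) =>
       forall t, (t < T)%N -> 0 < eta D T t <= etamax) :
  (0 < N)%N ->
  (forall j, smooth_fun (F j)) ->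
  (forall j, bounded_below (F j)) ->
  0 < Lr -> retraction_smooth g Rt f Lr ->
  distribution_on Pi -> unbiased g F f Pi ->
  0 < sigma -> variance_bounded g F f Pi sigma ->
  iid_samples P Pi xi ->
  (0 < K)%N -> (0 < l)%N -> (0 < lw)%N ->
  1 < gamma -> 1 < delta -> delta ^+ (2 * l) < gamma ->
  (l * K <= Tw)%N ->
  0 < eta0 -> warmup_ok w ->
  0 <= etamin -> etamin <= etamax -> etamax < 2 / Lr ->
  (exists2 C : R, 0 < C & forall T b : nat, (Tw < T)%N -> (0 < b)%N ->
     admissible Diminishing T ->
     (G2 Diminishing T b <=
        (C * (ln (T%:R / Tw%:R)
              * (Num.sqrt T.+1%:R - Num.sqrt Tw.+1%:R)^-1))%:E)%E) /\
  (forall D : decay R,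
     [\/ D = Constant, D = CosineAnnealing | exists p, D = PolyDecay p] ->
     exists2 C : R, 0 < C & forall T b : nat, (Tw < T)%N -> (0 < b)%N ->
       admissible D T ->
       (G2 D T b <= (C * ((T - Tw)%:R^-1 + b%:R^-1))%:E)%E).
Proof.
move=> N0 _ F_bounded Lr0 f_smooth Pi_dist F_unbiased sigma0 F_var xi_iid.
move=> K0 _ lw0 _ _ _ _ _ _ etamin0 etamin_le etamax_lt.
have [fmin fminP] := mean_fun_bounded_below F_bounded.
have Tw0 : (0 < Tw)%N by rewrite muln_gt0 lw0.
have Tw0R : 0 < Tw%:R :> R by rewrite ltr0n.
(* If [etamax] is nonpositive, the first rate cannot be both positive and at most [etamax], so both
   bounds hold vacuously. *)
have [etamax_le0|etamax0] := leP etamax 0.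
  have inadm D T : (Tw < T)%N -> ~ admissible D T.
    move=> TwT /(_ 0%N (leq_ltn_trans (leq0n _) TwT))/andP[lt0 le].
    by have := lt_le_trans lt0 (le_trans le etamax_le0); rewrite ltxx.
  by split=> [|D _]; exists 1 => // T b TwT _ /inadm - /(_ TwT).
pose kappa := 1 - Lr * etamax / 2; pose Delta := f x0 - fmin.
pose c := Lr / 2 * sigma ^+ 2 * etamax ^+ 2.
have kappa0 : 0 < kappa by move: etamax_lt; rewrite ltr_pdivlMr// /kappa; lra.
have Delta0 : 0 <= Delta by rewrite subr_ge0.
have c0 : 0 < c by rewrite !mulr_gt0 ?exprn_gt0// invr_gt0.
(* Common form of both rates: [S1] bounds the sum of the rates from below, and [etamax ^ 2 * Q]
   bounds the sum of their squares from above. *)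
have bound D T b (S1 Q : R) : (Tw < T)%N -> (0 < b)%N -> admissible D T ->
    0 < S1 -> S1 <= \sum_(t < T) eta D T t ->
    \sum_(t < T) eta D T t ^+ 2 <= etamax ^+ 2 * Q ->
    (G2 D T b <= ((Delta + c / b%:R * Q) / (kappa * S1))%:E)%E.
  move=> TwT b0 adm S10 S1le Qle.
  have T0 : (0 < T)%N := leq_ltn_trans (leq0n _) TwT.
  apply: (le_trans (min_grad_norm2_le x0 N0 Lr0 f_smooth Pi_dist F_unbiased
    F_var xi_iid fminP T0 b0 adm etamax_lt)).
  have k0 : 0 <= Lr / 2 * (sigma ^+ 2 / b%:R).
    by rewrite !mulr_ge0 ?invr_ge0 ?sqr_ge0// ltW.
  have S0 := lt_le_trans S10 S1le.
  rewrite lee_fin -/kappa -/Delta; apply: ler_pM.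
  - by rewrite addr_ge0// mulr_ge0// sumr_ge0// => t _; exact: sqr_ge0.
  - by rewrite invr_ge0 mulr_ge0 ?ltW.
  - have -> : c / b%:R * Q = Lr / 2 * (sigma ^+ 2 / b%:R) * (etamax ^+ 2 * Q).
      by rewrite /c; ring.
    by rewrite lerD2l ler_wpM2l.
  - by rewrite lef_pV2 ?posrE ?mulr_gt0// ler_pM2l.
have etaE D T t : (Tw <= t)%N -> eta D T t = decay_rate etamin etamax T D t.
  by move=> Twt; rewrite /eta /learning_rate ltnNge Twt.
have eta2_le D T t : (t < T)%N -> admissible D T -> eta D T t ^+ 2 <= etamax ^+ 2.
  by move=> tT /(_ _ tT)/andP[/ltW ? ?]; rewrite lerXn2r// nnegrE ltW.
have binv b : (0 < b)%N -> b%:R^-1 <= 1 :> R.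
  by move=> b0; rewrite invf_le1 ?ltr0n// ler1n.
split=> [|D hD].
  (* Least value of the logarithm over all [T > Tw]; dividing by it absorbs the terms constant in
     [T] into the logarithmic one. *)
  pose ell0 : R := ln (Tw.+1%:R / Tw%:R).
  have ell00 : 0 < ell0 by rewrite ln_gt0// ltr_pdivlMr// mul1r ltr_nat.
  exists (((Delta + c * Tw%:R) / ell0 + c) / (kappa * (etamax * 2))).
    rewrite divr_gt0 ?mulr_gt0// ltr_wpDl// divr_ge0 ?(ltW ell00)//.
    by rewrite addr_ge0// mulr_ge0 ?ltW.
  move=> T b TwT b0 adm; have T0 : (0 < T)%N := leq_ltn_trans (leq0n _) TwT.
  pose ell : R := ln (T%:R / Tw%:R).
  have ell_ge : ell0 <= ell.
    by rewrite ler_ln ?posrE ?divr_gt0 ?ltr0n// ler_pM2r ?invr_gt0// ler_nat.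
  pose gap : R := Num.sqrt T.+1%:R - Num.sqrt Tw.+1%:R.
  have gap0 : 0 < gap by rewrite subr_gt0 ltr_sqrt ?ltr0n// ltr_nat.
  have S1le : etamax * (2 * gap) <= \sum_(t < T) eta Diminishing T t.
    apply: (@le_trans _ _ (\sum_(Tw <= t < T) eta Diminishing T t)).
      rewrite (eq_big_nat _ _ (F2 := fun t => etamax * (Num.sqrt t.+1%:R)^-1)).
        by rewrite -mulr_sumr ler_pM2l// sum_inv_sqrt_ge// ltnW.
      by move=> t /andP[Twt _]; rewrite etaE.
    by apply: subsum_le => [t /adm/andP[/ltW]//|]; rewrite leqnn ltnW.
  (* Each warm-up step counts for 1 in [Q]; the squared decaying rates form a harmonic sum. *)
  have Qle : \sum_(t < T) eta Diminishing T t ^+ 2 <= etamax ^+ 2 * (Tw%:R + ell).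
    rewrite -(big_mkord predT (fun t => eta Diminishing T t ^+ 2)).
    rewrite (big_cat_nat (leq0n Tw) (ltnW TwT))/= mulrDr lerD//.
      rewrite -[X in _ * X%:R](subn0 Tw) mulr_natr -sumr_const_nat.
      apply: ler_sum_nat => t /andP[_ tTw].
      by apply: eta2_le => //; exact: ltn_trans TwT.
    have := @sum_inv_le_ln R Tw T; rewrite Tw0 (ltnW TwT) => /(_ isT) sum_le.
    apply: le_trans (ler_wpM2l (sqr_ge0 _) sum_le).
    rewrite mulr_sumr; apply: ler_sum_nat => t /andP[Twt _].
    by rewrite etaE//= expr_div_n sqr_sqrtr.
  have S10 : 0 < etamax * (2 * gap) by rewrite !mulr_gt0.
  apply: (le_trans (bound _ _ _ _ _ TwT b0 adm S10 S1le Qle)).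
  rewrite lee_fin -/ell -/gap.
  have -> : kappa * (etamax * (2 * gap)) = kappa * (etamax * 2) * gap by ring.
  rewrite [in leLHS]invfM [leLHS]mulrA [leRHS]mulrA ler_pM2r ?invr_gt0//.
  rewrite [leRHS]mulrAC ler_pM2r ?invr_gt0 ?mulr_gt0//.
  have ell_pos : 0 < ell := lt_le_trans ell00 ell_ge.
  apply: (@le_trans _ _ (Delta + c * Tw%:R + c * ell)).
    have := binv _ b0; have : 0 <= c * (Tw%:R + ell).
      by rewrite mulr_ge0 ?addr_ge0// ltW.
    move=> cQ /(ler_wpM2l cQ); rewrite mulr1 mulrAC => le_cQ.
    by rewrite -[leRHS]addrA -mulrDr lerD2l.
  rewrite mulrDl lerD2r [leRHS]mulrAC ler_pdivlMr//.
  by rewrite ler_wpM2l// addr_ge0// mulr_ge0 ?ltW.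
have [theta theta0 decay_ge] := decay_rate_ge Tw etamin0 etamin_le hD.
(* Chosen so that [1 / (kappa * S1) = k / n'] for the lower bound [S1] used below. *)
pose k := 2 / (kappa * (theta * etamax)).
have k0 : 0 < k by rewrite divr_gt0 ?mulr_gt0.
exists (k * (Delta + c * Tw%:R + c)).
  by rewrite mulr_gt0// ltr_wpDl// addr_ge0// mulr_ge0 ?ltW.
move=> T b TwT b0 adm; pose n' := (T - Tw)%N.
have n0 : 0 < n'%:R :> R by rewrite ltr0n subn_gt0.
have S10 : 0 < theta * etamax * (n'%:R / 2) by rewrite !mulr_gt0 ?invr_gt0.
have S1le : theta * etamax * (n'%:R / 2) <= \sum_(t < T) eta D T t.
  have [hT n'h half] := half_window TwT; set h := (Tw + _)%N in hT n'h half.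
  apply: (@le_trans _ _ (\sum_(Tw <= t < h) eta D T t)); last first.
    by apply: subsum_le => [t /adm/andP[/ltW]//|]; rewrite leq_addr.
  apply: (@le_trans _ _ (\sum_(Tw <= t < h) theta * etamax)).
    rewrite sumr_const_nat -[leRHS]mulr_natr ler_pM2l ?mulr_gt0//.
    by rewrite ler_pdivrMr// -natrM ler_nat.
  apply: ler_sum_nat => t /andP[Twt th]; rewrite etaE//.
  by apply: decay_ge => //; apply: half; rewrite Twt.
have Qle : \sum_(t < T) eta D T t ^+ 2 <= etamax ^+ 2 * T%:R.
  rewrite mulr_natr -[X in _ *+ X]card_ord -sumr_const.
  by apply: ler_sum => t _; exact: eta2_le.
apply: (le_trans (bound _ _ _ _ _ TwT b0 adm S10 S1le Qle)).
rewrite lee_fin -/n'.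
(* In [c * T / (b * n')] the share of [Tw] is of order [1 / n'] because [1 / b <= 1], while the
   share of [n'] cancels and leaves [c / b]. *)
have TE : T%:R = Tw%:R + n'%:R :> R by rewrite -natrD subnKC// ltnW.
have b0R : 0 < b%:R :> R by rewrite ltr0n.
have -> : (Delta + c / b%:R * T%:R) / (kappa * (theta * etamax * (n'%:R / 2))) =
    k * (Delta / n'%:R + c * Tw%:R / n'%:R * b%:R^-1 + c / b%:R).
  by rewrite TE /k; field; rewrite !lt0r_neq0.
rewrite -[leRHS]mulrA ler_pM2l//.
have cTw0 : 0 <= c * Tw%:R by rewrite mulr_ge0 ?ltW.
have nV0 : 0 <= n'%:R^-1 :> R by rewrite invr_ge0.
have bV0 : 0 <= b%:R^-1 :> R by rewrite invr_ge0.
have := ler_wpM2l (mulr_ge0 cTw0 nV0) (binv _ b0).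
have := mulr_ge0 Delta0 bV0; have := mulr_ge0 cTw0 bV0.
have := mulr_ge0 (ltW c0) nV0.
by rewrite !mulrDl !mulrDr; lra.
Qed.
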